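(* Let $K$ be a field and let $C$ be a cycle with vertex set $V(C)=\{1,\ldots,u\}$, $u\ge3$, and edge set $E(C)=\{(1,2),\ldots,(u-1,u),(u,1)\}$. Let $J$ be the cover ideal of $C$ and $\mathcal I=\{J^{(n)}\}$. Then for any $\mathfrak p\in\overline A(\mathcal I)$ and $n\ge1$, $$v_{\mathfrak p}(J^{(n)})=\begin{cases}\frac{|V(C)|}{2}n+c&\text{if } n\text{ is even},\\[2pt] \frac{|V(C)|}{2}n+d&\text{if } n\text{ is odd},\end{cases}$$ where $c=d=0$ if $C$ is an even cycle (i.e. $u$ is even), and $c=0$, $d=-\frac12$ if $C$ is an odd cycle (i.e. $u$ is odd).
   Context: The cover ideal of a finite simple graph $G$ with vertices $1,\ldots,u$ is $J(G)=\bigcap_{(i,j)\in E(G)}\langle x_i,x_j\rangle\subset R=K[x_1,\ldots,x_u]$, with $R$ standard graded. The $n$-th symbolic power is $J^{(n)}=\bigcap_{Q\in\operatorname{Ass}(R/J)}(J^nR_Q\cap R)$. $\overline A(\mathcal I)$ denotes the stable set $\operatorname{Ass}(R/J^{(n)})$ for $n\gg0$. For a homogeneous ideal $I$ of $R=\bigoplus_nR_n$ and $\mathfrak p\in\operatorname{Ass}(R/I)$, the local $v$-number is $v_{\mathfrak p}(I)=\min\{u:\text{there exists } f\in R_u\text{ with }\mathfrak p=(I:f)\}$. *)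

(* Defs.v *)
From mathcomp Require Export all_boot all_order all_algebra.
From mathcomp Require Export classical_sets.
From mathcomp Require Export mpoly.
From mathcomp Require Import zify.

Set Implicit Arguments.
Unset Strict Implicit.
Unset Printing Implicit Defensive.

Import GRing.Theory.
Local Open Scope classical_set_scope.
Local Open Scope ring_scope.

Section Ideals.
Variable R : idomainType.
Implicit Types (S I P Q : set R) (f : R).

Definition ideal I : Prop :=
  [/\ I 0, forall a b, I a -> I b -> I (a + b) & forall r a, I a -> I (r * a)].

Definition prime_ideal P : Prop :=
  [/\ ideal P, ~ P 1 & forall a b, P (a * b) -> P a \/ P b].

Definition ideal_gen S : set R :=
  [set f | exists2 s : seq (R * R),
     forall c, c \in s -> S c.2 & f = \sum_(c <- s) c.1 * c.2].

Definition ideal_mul I1 I2 : set R :=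
  ideal_gen [set a * b | a in I1 & b in I2].

Definition ideal_pow I n : set R := iter n (ideal_mul I) setT.

Definition colon I f : set R := [set g | I (g * f)].

(* [colon I f] is the annihilator of the class of [f] in the module R/I. *)
Definition Ass I : set (set R) :=
  [set P | prime_ideal P /\ exists f, P = colon I f].

(* For [Q] prime, R_Q is realized inside the fraction field of R. *)
Definition localization Q : set {fraction R} :=
  [set y | exists a s, ~ Q s /\ y = tofrac a / tofrac s].

(* The ideal I R_Q of R_Q. *)
Definition extension I Q : set {fraction R} :=
  [set y | exists2 s : seq ({fraction R} * R),
     forall c, c \in s -> localization Q c.1 /\ I c.2
     & y = \sum_(c <- s) c.1 * tofrac c.2].

(* I R_Q `&` R *)
Definition contraction I Q : set R := [set f | extension I Q (tofrac f)].

Definition symbolic_power I n : set R :=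
  \bigcap_(Q in Ass I) contraction (ideal_pow I n) Q.

(* The primes lying in Ass (R / I_n) for all large n; whenever the sets
   Ass (R / I_n) are eventually constant, this is their eventual value. *)
Definition stable_Ass (I_ : nat -> set R) : set (set R) :=
  [set P | exists N, forall n, (N <= n)%N -> Ass (I_ n) P].

End Ideals.

Definition is_local_vnumber (K : fieldType) (u : nat)
    (I P : set {mpoly K[u]}) (v : nat) : Prop :=
  let realized d := exists2 f, f \is d.-homog & P = colon I f in
  [/\ Ass I P, realized v & forall d, realized d -> (v <= d)%N].

Definition cover_ideal (K : fieldType) (u : nat) (E : rel 'I_u) :
    set {mpoly K[u]} :=
  \bigcap_(e in [set e : 'I_u * 'I_u | E e.1 e.2])
     ideal_gen [set 'X_(e.1); 'X_(e.2)].
Arguments cover_ideal K {u} E _.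

(* Vertices are numbered 0, ..., u-1, and [ordS] is the successor modulo u. *)
Definition cycle_graph (u : nat) : rel 'I_u :=
  fun i j => (j == ordS i) || (i == ordS j).
Arguments cycle_graph u i j : clear implicits.

Lemma cycle_graph_sym u : ssrbool.symmetric (cycle_graph u).
Proof. by move=> i j; rewrite /cycle_graph orbC. Qed.

Lemma cycle_graph_irrefl u : (3 <= u)%N -> irreflexive (cycle_graph u).
Proof.
move=> hu i; rewrite /cycle_graph orbb; apply/negbTE/eqP => /(congr1 val) /=.
have := ltn_ord i; case: (ltngtP i.+1 u) => // [lt _|eq _].
  by rewrite modn_small //; lia.
by rewrite eq modnn; lia.
Qed.

(* Main.v *)
(* The cover ideal is the intersection of the monomial primes p_e = (x_i, x_j)
   over the edges e, and its n-th symbolic power is the intersection of the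
   p_e^n, for which a monomial x^a is tested edge by edge: a_i + a_j >= n.
   A monomial x^a has colon p_e iff a_i + a_j = n - 1 on e and the sum is at
   least n on every other edge; summing over the u edges of the cycle counts
   each vertex twice, so 2 |a| >= u n - 1. The bound floor(u n / 2) is attained
   by exponents alternating between floor(n / 2) and ceil(n / 2) around the
   cycle, suitably corrected at the two ends; hence the local v-number is
   floor(u n / 2) for every edge. *)
Require Import Defs.
From mathcomp Require Import zify.
Import GRing.Theory.
Set Implicit Arguments.
Unset Strict Implicit.
Unset Printing Implicit Defensive.
Local Open Scope classical_set_scope.
Local Open Scope ring_scope.

(** * Ideals, primes and contraction from a localization *)

Section IdealTheory.
Variable R : idomainType.
Implicit Types (S I P Q : set R) (f : R).

Lemma ideal_sum I (T : eqType) (r : seq T) (p : pred T) (F : T -> R) :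
  ideal I -> (forall c, c \in r -> p c -> I (F c)) -> I (\sum_(c <- r | p c) F c).
Proof.
move=> [I0 ID _] IF; rewrite big_seq_cond; apply: big_ind => // c.
by case/andP; apply: IF.
Qed.

Lemma ideal_mulr I a b : ideal I -> I a -> I (a * b).
Proof. by move=> [_ _ IM] Ia; rewrite mulrC; apply: IM. Qed.

Lemma ideal_gen_ideal S : ideal (ideal_gen S).
Proof.
split.
- by exists [::] => //; rewrite big_nil.
- move=> _ _ [s sS ->] [t tS ->]; exists (s ++ t); last by rewrite big_cat.
  by move=> c; rewrite mem_cat => /orP[/sS|/tS].
- move=> r _ [s sS ->]; exists [seq (r * c.1, c.2) | c <- s].
    by move=> _ /mapP[c /sS Sc ->].
  by rewrite big_map mulr_sumr; apply: eq_bigr => c _; rewrite mulrA.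
Qed.

Lemma sub_ideal_gen S : S `<=` ideal_gen S.
Proof.
move=> a Sa; exists [:: (1, a)]; last by rewrite big_seq1 mul1r.
by move=> c; rewrite inE => /eqP->.
Qed.

Lemma ideal_gen_sub S I : ideal I -> S `<=` I -> ideal_gen S `<=` I.
Proof.
move=> idI SI _ [s sS ->]; have [_ _ IM] := idI.
by apply: ideal_sum => // c /sS Sc _; apply/IM/SI.
Qed.

Lemma ideal_pow_ideal I n : ideal (ideal_pow I n).
Proof. by case: n => [|n]; [split | apply: ideal_gen_ideal]. Qed.

Lemma prime_ideal_prod P (T : eqType) (r : seq T) (F : T -> R) :
  prime_ideal P -> (forall c, c \in r -> ~ P (F c)) -> ~ P (\prod_(c <- r) F c).
Proof.
move=> [_ P1 PM] nPF; rewrite big_seq; apply: (big_ind (fun x => ~ P x)) => //.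
by move=> a b Pa Pb /PM[].
Qed.

Lemma prime_ideal_exp P a n : prime_ideal P -> ~ P a -> ~ P (a ^+ n).
Proof.
by move=> Pp Pa; rewrite -[n]subn0 -prodr_const_nat; apply: prime_ideal_prod.
Qed.

(** Clearing denominators one summand at a time yields a common denominator, which stays outside [Q]
    because [Q] is prime. *)
Lemma contractionP I Q f : ideal I -> prime_ideal Q ->
  contraction I Q f <-> exists2 s, ~ Q s & I (s * f).
Proof.
move=> idI Qp; have [[Q0 _ _] Q1 QM] := Qp; have [I0 ID IM] := idI; split.
- case=> r rP fE.
  suff [s [g [Qs Ig]]] : exists s g, [/\ ~ Q s, I g & tofrac s * tofrac f = tofrac g].
    by move/eqP; rewrite -tofracM tofrac_eq => /eqP sfE; exists s; rewrite ?sfE.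
  rewrite {}fE; elim: r rP => [|[y c] r IHr] rP.
    by exists 1, 0; split; rewrite // big_nil mulr0 tofrac0.
  have [|s [g [Qs Ig sE]]] := IHr.
    by move=> d rd; apply: rP; rewrite inE rd orbT.
  have /= [[a [t [Qt yE]]] Ic] := rP _ (mem_head _ _).
  have t0 : tofrac t != 0.
    by rewrite tofrac_eq0; apply/eqP => t0; rewrite t0 in Qt.
  exists (s * t), (s * a * c + t * g); split; first by case/QM.
    by apply: ID; apply: IM.
  rewrite big_cons /= tofracD !tofracM -sE yE mulrDr; congr (_ + _).
    by rewrite !mulrA; congr (_ * _); rewrite -!mulrA [tofrac t * _]mulrC divfK.
  by rewrite !mulrA [tofrac s * tofrac t]mulrC.
- case=> s Qs Isf; exists [:: ((tofrac s)^-1, s * f)].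
    move=> c; rewrite inE => /eqP-> /=; split=> //.
    by exists 1, s; rewrite tofrac1 div1r.
  rewrite big_seq1 /= tofracM mulKf // tofrac_eq0.
  by apply/eqP => s0; rewrite s0 in Qs.
Qed.

End IdealTheory.

(** * Order of vanishing of univariate polynomials *)

Section LowCoefficients.
Variable R : idomainType.
Implicit Types p q : {poly R}.

Lemma low_coefM p q a b :
    (forall k, (k < a)%N -> p`_k = 0) -> (forall k, (k < b)%N -> q`_k = 0) ->
  forall k, (k < a + b)%N -> (p * q)`_k = 0.
Proof.
move=> pa qb k kab; rewrite coefM big1 // => j _.
have [ja|ja] := ltnP j a; first by rewrite pa ?mul0r.
by rewrite qb ?mulr0 //; have := ltn_ord j; lia.
Qed.

(** By strong induction on [k], only the term of [p] in degree 0 survives in coefficient [k] of the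
    product, and it cancels in a domain. *)
Lemma low_coef_cancel p q n : p`_0 != 0 ->
    (forall k, (k < n)%N -> (p * q)`_k = 0) ->
  forall k, (k < n)%N -> q`_k = 0.
Proof.
move=> p0 pqn; elim/ltn_ind=> k IHk kn; have /eqP := pqn k kn.
rewrite coefM big_ord_recl big1 => [|j _].
  by rewrite addr0 subn0 mulf_eq0 (negPf p0) => /eqP.
by rewrite IHk ?mulr0 // /=; have := ltn_ord j; rewrite /bump; lia.
Qed.

End LowCoefficients.

(** * Powers of monomial primes *)

Section OrderIdeal.
Variables (K : fieldType) (u : nat).
Implicit Types (A B : {set 'I_u}) (m : 'X_{1.. u}) (f g : {mpoly K[u]}).

Definition wdeg A m := (\sum_(k in A) m k)%N.

(* The n-th power (equivalently, symbolic power) of the monomial prime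
   generated by the variables in A. *)
Definition prime_pow A n : set {mpoly K[u]} :=
  [set f | forall m, m \in msupp f -> (n <= wdeg A m)%N].

Lemma wdegD A m1 m2 : wdeg A (m1 + m2)%MM = (wdeg A m1 + wdeg A m2)%N.
Proof. by rewrite -big_split; apply: eq_bigr => k _; rewrite mnmDE. Qed.

Lemma wdegU A k : wdeg A U_(k)%MM = (k \in A).
Proof.
rewrite /wdeg; have [Ak|Ak] := boolP (k \in A).
  rewrite (bigD1 k) //= mnm1E eqxx big1 // => j /andP[_ /negPf jk].
  by rewrite mnm1E eq_sym jk.
by rewrite big1 // => j Aj; rewrite mnm1E; case: eqP Ak => // ->; rewrite Aj.
Qed.

(* Substituting t x_k for the variables x_k in A turns [prime_pow A n] into
   the preimage of the ideal (t ^ n). *)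
Definition tsubst A : {mpoly K[u]} -> {poly {mpoly K[u]}} :=
  mmap (polyC \o mpolyC u (R := K)) (fun k => ('X_k : {mpoly K[u]})%:P * 'X^(k \in A)).

Lemma tsubstM A f g : tsubst A (f * g) = tsubst A f * tsubst A g.
Proof. exact: rmorphM. Qed.

(** Each monomial is kept and multiplied by t to its weighted degree, so distinct monomials never
    merge and the order in t can be read off the support. *)
Lemma mcoeff_tsubst A f k m :
  ((tsubst A f)`_k)@_m = f@_m *+ (k == wdeg A m).
Proof.
have XE m' : mmap1 (fun k => ('X_k : {mpoly K[u]})%:P * 'X^(k \in A)) m'
    = 'X_[m']%:P * 'X^(wdeg A m').
  rewrite /mmap1 mpolyXE_id rmorph_prod /=.
  under eq_bigr do rewrite exprMn -exprM -rmorphXn.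
  rewrite big_split /=; congr (_ * _).
  rewrite /wdeg prodrXr [in RHS]big_mkcond /=; congr ('X^_).
  by apply: eq_bigr => i _; case: ifP; rewrite ?mul1n ?mul0n.
rewrite /tsubst /mmap coef_sum linear_sum /=.
rewrite [in RHS](mpolyE f) linear_sum -sumrMnl /=; apply: eq_bigr => m' _.
rewrite XE mulrA -polyCM coefCM coefXn mul_mpolyC mcoeffZ mcoeffX.
rewrite -scalerAl mcoeffZ mulr_natr mcoeffMn mcoeffX.
by have [->|_] := eqVneq m' m; rewrite ?mul0rn ?mulr0 ?mul0rn // mulrnAr.
Qed.

Lemma prime_powP A n f :
  prime_pow A n f <-> forall k, (k < n)%N -> (tsubst A f)`_k = 0.
Proof.
split=> [fn k kn|f0 m fm].
  apply/mpolyP => m; rewrite mcoeff_tsubst mcoeff0.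
  have [fm|] := boolP (m \in msupp f); last by rewrite -mcoeff_eq0 => /eqP->; rewrite mul0rn.
  by have := fn _ fm; case: eqP => // <-; rewrite leqNgt kn.
rewrite leqNgt; apply/negP => /f0 /(congr1 (mcoeff m)) /eqP.
by rewrite mcoeff_tsubst eqxx mcoeff0 mcoeff_eq0 fm.
Qed.

Lemma prime_pow_mul A a b f g :
  prime_pow A a f -> prime_pow A b g -> prime_pow A (a + b) (f * g).
Proof.
move=> /prime_powP fa /prime_powP gb; apply/prime_powP; rewrite tsubstM.
exact: low_coefM.
Qed.

Lemma prime_pow_ideal A n : ideal (prime_pow A n).
Proof.
split.
- by move=> m; rewrite msupp0.
- by move=> a b an bn m /msuppD_le; rewrite mem_cat => /orP[/an|/bn].
- by move=> r a; apply: (@prime_pow_mul A 0).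
Qed.

Lemma prime_powX A n m : prime_pow A n 'X_[m] <-> (n <= wdeg A m)%N.
Proof.
split=> [|nm m']; last by rewrite msuppX inE => /eqP->.
by apply; rewrite msuppX mem_head.
Qed.

Lemma prime_powXi A k : prime_pow A 1 'X_k <-> k \in A.
Proof. by rewrite prime_powX wdegU lt0b. Qed.

(** If [s] is outside the prime, its image under [tsubst] has nonzero constant coefficient in t, so
    multiplying by [s] does not raise the order. *)
Lemma prime_pow_primary A n s f :
  ~ prime_pow A 1 s -> prime_pow A n (s * f) -> prime_pow A n f.
Proof.
move=> sA /prime_powP sfn; apply/prime_powP.
have s0 : (tsubst A s)`_0 != 0.
  by apply/eqP => s0; apply: sA; apply/prime_powP => -[].
by apply: low_coef_cancel s0 _; rewrite -tsubstM.
Qed.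

Lemma prime_pow_prime A : prime_ideal (prime_pow A 1).
Proof.
split; first exact: prime_pow_ideal.
  by rewrite -mpolyX0 prime_powX /wdeg big1 // => k _; rewrite mnm0E.
move=> a b ab; have [->|/eqP a0] := eqVneq a 0.
  by left; case: (prime_pow_ideal A 1).
have [aA|aA] := boolp.pselect (prime_pow A 1 a); [by left | right].
exact: prime_pow_primary ab.
Qed.

Lemma mpoly_ideal I f : ideal I ->
  (forall m, m \in msupp f -> I 'X_[m]) -> I f.
Proof.
move=> idI fI; rewrite (mpolyE f); apply: ideal_sum => // m fm _.
by have [_ _ IM] := idI; rewrite -mul_mpolyC; apply/IM/fI.
Qed.

Lemma wdeg_gt0 A m : (0 < wdeg A m)%N -> exists2 k, k \in A & (0 < m k)%N.
Proof.
rewrite lt0n sum_nat_eq0 => /forall_inPn[k Ak mk].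
by exists k; rewrite // lt0n.
Qed.

Lemma mnm_gt0 m k : (0 < m k)%N -> exists m', m = (U_(k) + m')%MM.
Proof.
move=> mk; exists (m - U_(k))%MM; rewrite addmC submK //.
by apply/mnm_lepP => j; rewrite mnm1E; case: eqP => // <-.
Qed.

Lemma prime_pow1_gen A :
  prime_pow A 1 = ideal_gen [set f | exists2 k, k \in A & f = 'X_k].
Proof.
apply/seteqP; split=> [f fA|]; last first.
  by apply: ideal_gen_sub; [apply: prime_pow_ideal | move=> _ [k Ak ->]; apply/prime_powXi].
apply: mpoly_ideal => [|m /fA /wdeg_gt0[k Ak /mnm_gt0[m' ->]]].
  exact: ideal_gen_ideal.
rewrite mpolyXD; apply: ideal_mulr; first exact: ideal_gen_ideal.
by apply: sub_ideal_gen; exists k.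
Qed.

Lemma prime_pow1_sub A I : ideal I ->
  (forall k, k \in A -> I 'X_k) -> prime_pow A 1 `<=` I.
Proof.
by move=> idI AI; rewrite prime_pow1_gen; apply: ideal_gen_sub => // _ [k Ak ->]; apply: AI.
Qed.

End OrderIdeal.

(** * Symbolic powers of an intersection of incomparable monomial primes *)

Section SquarefreeMonomialIdeal.
Variables (K : fieldType) (u : nat) (T : finType) (A : T -> {set 'I_u}).
Hypothesis A_incomparable : forall i j, A i \subset A j -> i = j.
Implicit Types (i j : T) (m : 'X_{1.. u}) (f g : {mpoly K[u]}) (n : nat).

Notation pp := (@prime_pow K u).

Definition inter_pow n : set {mpoly K[u]} := [set f | forall i, pp (A i) n f].

Lemma inter_pow_ideal n : ideal (inter_pow n).
Proof.
split.
- by move=> i; case: (prime_pow_ideal K (A i) n).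
- by move=> a b an bn i; case: (prime_pow_ideal K (A i) n) => _ + _; apply.
- by move=> r a an i; case: (prime_pow_ideal K (A i) n) => _ _; apply.
Qed.

(** The monomial falls short by exactly one on [A i] and nowhere else, so a multiplier only has to
    contribute one factor from the prime of [A i]. *)
Lemma inter_pow_colonX n i m :
    wdeg (A i) m = n -> (forall j, j != i -> n.+1 <= wdeg (A j) m)%N ->
  pp (A i) 1 = colon (inter_pow n.+1) 'X_[m].
Proof.
move=> mi mj; apply/seteqP; split=> [g gi j|g /(_ i) gm].
  have [->|ji] := eqVneq j i.
    by rewrite -add1n; apply: prime_pow_mul => //; apply/prime_powX; rewrite mi.
  by case: (prime_pow_ideal K (A j) n.+1) => _ _; apply; apply/prime_powX/mj.
apply: boolp.contrapT => /prime_pow_primary /(_ gm) /prime_powX.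
by rewrite mi ltnn.
Qed.

Lemma Ass_inter_powX n i m :
    wdeg (A i) m = n -> (forall j, j != i -> n.+1 <= wdeg (A j) m)%N ->
  Ass (inter_pow n.+1) (pp (A i) 1).
Proof.
move=> mi mj; split; first exact: prime_pow_prime.
by exists 'X_[m]; apply: inter_pow_colonX.
Qed.

(** [Q] contains some component prime because it is prime and contains the intersection; it lies
    inside one because [f] misses some component. Incomparability identifies the two. *)
Lemma Ass_inter_pow_sub n Q : Ass (inter_pow n) Q -> exists i, Q = pp (A i) 1.
Proof.
move=> [Qp [f QE]]; have [idQ Q1 QM] := Qp.
have [i Qi] : exists i, forall k, k \in A i -> Q 'X_k.
  apply: boolp.contrapT => nQ.
  have kP i : exists k, k \in A i /\ ~ Q 'X_k.
    apply: boolp.contrapT => nk; apply: nQ; exists i => k Ak.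
    by apply: boolp.contrapT => nQk; apply: nk; exists k.
  have [k kE] := boolp.choice kP.
  (* Choosing in each component a variable outside [Q], the product of their [n]-th powers lies in
     every component, hence in [Q]. *)
  apply: (@prime_ideal_prod _ Q _ (enum T) (fun i => 'X_(k i) ^+ n)) => //.
    by move=> i _; apply: prime_ideal_exp => //; case: (kE i).
  rewrite QE /colon /=; apply: ideal_mulr (inter_pow_ideal n) _.
  move=> i; rewrite (bigD1_seq i) ?enum_uniq ?mem_enum //=.
  apply: ideal_mulr (prime_pow_ideal K (A i) n) _.
  rewrite mpolyXn; apply/prime_powX.
  rewrite /wdeg (bigD1 (k i)) /=; last by case: (kE i).
  by rewrite mulmnE mnm1E eqxx mul1n leq_addr.
have [j nfj] : exists j, ~ pp (A j) n f.
  apply: boolp.contrapT => nf; apply: Q1; rewrite QE /colon /= mul1r => j.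
  by apply: boolp.contrapT => nfj; apply: nf; exists j.
have Qj : Q `<=` pp (A j) 1.
  move=> g; rewrite QE => /(_ j) gf; apply: boolp.contrapT => gj.
  by apply: nfj; apply: prime_pow_primary gf.
have ij : i = j by apply/A_incomparable/fintype.subsetP => k /Qi /Qj /prime_powXi.
subst j; exists i; apply/seteqP; split=> //; exact: prime_pow1_sub.
Qed.

(* The product of the variables outside A i: it lies in every other prime, and
   inverting it kills every component except the one of A i. *)
Definition off_mnm i : 'X_{1.. u} := [multinom (k \notin A i : nat) | k < u].

Lemma wdeg_off i : wdeg (A i) (off_mnm i) = 0%N.
Proof. by apply: big1 => k Ak; rewrite mnmE Ak. Qed.

Lemma wdeg_off_gt0 i j : j != i -> (0 < wdeg (A j) (off_mnm i))%N.
Proof.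
move=> ji; rewrite lt0n; apply: contra ji; rewrite sum_nat_eq0 => /forall_inP off0.
apply/eqP/A_incomparable/fintype.subsetP => k /off0; rewrite mnmE.
by case: (k \in A i).
Qed.

Lemma Ass_inter_pow1 : Ass (inter_pow 1) = [set pp (A i) 1 | i in setT].
Proof.
apply/seteqP; split=> [Q /Ass_inter_pow_sub[i ->]|_ [i _ <-]]; first by exists i.
apply: (@Ass_inter_powX 0 i (off_mnm i)); first exact: wdeg_off.
exact: wdeg_off_gt0.
Qed.

Lemma ideal_pow_inter_sub n i :
  ideal_pow (inter_pow 1) n `<=` pp (A i) n.
Proof.
elim: n => [|n IHn]; first by move=> f _ m.
apply: ideal_gen_sub; first exact: prime_pow_ideal.
move=> _ [a aJ [b bJ <-]]; rewrite -add1n; apply: prime_pow_mul; first exact: aJ.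
exact: IHn.
Qed.

(** Each variable of [A i] extracted from [m] is paired with one copy of [off_mnm i]; the pair lies
    in every component prime. *)
Lemma off_pow_mul n i m : (n <= wdeg (A i) m)%N ->
  ideal_pow (inter_pow 1) n ('X_[off_mnm i] ^+ n * 'X_[m]).
Proof.
elim: n m => [//|n IHn] m nm.
have [k Ak mk] : exists2 k, k \in A i & (0 < m k)%N.
  by apply: wdeg_gt0; apply: leq_trans nm.
have [m' mE] := mnm_gt0 mk; subst m.
move: nm; rewrite wdegD wdegU Ak add1n ltnS => /IHn IH.
apply: sub_ideal_gen; exists ('X_[off_mnm i] * 'X_k).
  move=> j; rewrite -mpolyXD; apply/prime_powX; rewrite wdegD wdegU.
  have [->|/wdeg_off_gt0] := eqVneq j i; first by rewrite Ak addn1.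
  by move=> h; apply: leq_trans (leq_addr _ _).
by exists ('X_[off_mnm i] ^+ n * 'X_[m']); rewrite // exprS mpolyXD mulrACA.
Qed.

Lemma contraction_inter_pow n i :
  contraction (ideal_pow (inter_pow 1) n) (pp (A i) 1) = pp (A i) n.
Proof.
have prI := prime_pow_prime K (A i); have idJ := ideal_pow_ideal (inter_pow 1) n.
apply/seteqP; split=> f.
  move=> /(contractionP _ idJ prI)[s si sf].
  exact: prime_pow_primary si (ideal_pow_inter_sub i sf).
move=> fi; apply/(contractionP _ idJ prI); exists ('X_[off_mnm i] ^+ n).
  apply: prime_ideal_exp => //; move/prime_powX.
  by rewrite wdeg_off.
rewrite (mpolyE f) mulr_sumr; apply: ideal_sum => // m fm _.
rewrite -scalerAr -mul_mpolyC; have [_ _] := idJ; apply.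
exact/off_pow_mul/fi.
Qed.

Lemma symbolic_power_inter n : symbolic_power (inter_pow 1) n = inter_pow n.
Proof.
apply/seteqP; split=> f fP.
  move=> i; rewrite -contraction_inter_pow; apply: fP.
  by rewrite Ass_inter_pow1; exists i.
move=> Q; rewrite Ass_inter_pow1 => -[i _ <-].
by rewrite contraction_inter_pow; apply: fP.
Qed.

(* Each variable of A i corrects every component missed by the monomial m of
   f, so A i is contained in each A j for which m has too small a degree. *)
Lemma colon_inter_pow_mnm n i k f : k \in A i ->
    pp (A i) 1 = colon (inter_pow n) f ->
  exists2 m, m \in msupp f &
    (n <= (wdeg (A i) m).+1)%N /\ forall j, j != i -> (n <= wdeg (A j) m)%N.
Proof.
move=> Ak iE.
have [m [j [fm mj]]] : exists m j, m \in msupp f /\ (wdeg (A j) m < n)%N.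
  apply: boolp.contrapT => nf; have [_ + _] := prime_pow_prime K (A i).
  rewrite iE; apply; rewrite /colon /= mul1r => j m fm.
  by rewrite leqNgt; apply/negP => mj; apply: nf; exists m, j.
have mX k' j' : k' \in A i -> (n <= (k' \in A j') + wdeg (A j') m)%N.
  move=> /(prime_powXi K); rewrite iE => /(_ j' (U_(k') + m)%MM).
  rewrite wdegD wdegU; apply.
  by rewrite mulrC mcoeff_msupp mcoeffMX -mcoeff_msupp.
have jP j' : (wdeg (A j') m < n)%N -> i = j'.
  move=> mj'; apply/A_incomparable/fintype.subsetP => k' /(mX k' j').
  by case: (k' \in A j') => //; rewrite add0n leqNgt mj'.
exists m => //; split; first by have := mX k i Ak; rewrite Ak add1n.
by move=> j' ji; rewrite leqNgt; apply: contra ji => /jP->.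
Qed.

End SquarefreeMonomialIdeal.

(** * Edges of the cycle and extremal exponents *)

Section Cycle.
Variables (u : nat) (hu : (3 <= u)%N).
Implicit Types (i j : 'I_u) (m : 'X_{1.. u}) (n : nat).

Definition cycle_edge i : {set 'I_u} := [set i; ordS i]%SET.

Lemma ordS_neq i : ordS i != i.
Proof.
have := cycle_graph_irrefl hu i; rewrite /cycle_graph orbb eq_sym.
by move=> ->.
Qed.

(** Rules out two edges that coincide with reversed ends, as would happen for [u = 2]. *)
Lemma ordSS_neq i : ordS (ordS i) != i.
Proof.
apply/eqP => /(congr1 val) /=; have := ltn_ord i.
have [lt|] := ltnP i.+1 u; last first.
  by move=> ui iu; have -> : i.+1 = u by [lia]; rewrite modnn modn_small //; lia.
rewrite (modn_small lt) => _; have [lt2|] := ltnP i.+2 u.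
  by rewrite modn_small //; lia.
by move=> ui; have -> : i.+2 = u by [lia]; rewrite modnn; lia.
Qed.

Lemma cycle_edge_incomparable i j :
  cycle_edge i \subset cycle_edge j -> i = j.
Proof.
move/fintype.subsetP => ij.
have /set2P[//|iE] := ij i (set21 _ _).
have /set2P[E|E] := ij (ordS i) (set22 _ _).
  by have := ordSS_neq j; rewrite -iE E eqxx.
exact: ordS_inj E.
Qed.

Lemma cover_ideal_cycle (K : fieldType) :
  cover_ideal K (cycle_graph u) = inter_pow cycle_edge 1.
Proof.
have edgeE i j : ideal_gen [set 'X_i; 'X_j : {mpoly K[u]}] =
    prime_pow [set i; j]%SET 1.
  rewrite prime_pow1_gen; congr ideal_gen; apply/seteqP; split=> f /=.
    by case=> ->; [exists i | exists j]; rewrite ?set21 ?set22.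
  by case=> k /set2P[]-> ->; [left | right].
apply/seteqP; split=> f fE.
  move=> i; have := fE (i, ordS i); rewrite edgeE; apply.
  by rewrite /= /cycle_graph eqxx.
case=> i j; rewrite /= edgeE => /orP[/eqP->|/eqP->]; first exact: fE.
by rewrite finset.setUC; apply: fE.
Qed.

Lemma wdeg_cycle_edge i m : wdeg (cycle_edge i) m = (m i + m (ordS i))%N.
Proof. by rewrite /wdeg big_setU1 ?big_set1 // inE eq_sym ordS_neq. Qed.

Lemma sum_wdeg_cycle m : (\sum_i wdeg (cycle_edge i) m = (mdeg m).*2)%N.
Proof.
under eq_bigr do rewrite wdeg_cycle_edge.
rewrite big_split /= -addnn mdegE; congr (_ + _)%N.
by rewrite [RHS](reindex_inj (@ordS_inj u)).
Qed.

Lemma mdeg_cycle_ge n i m : (n <= (wdeg (cycle_edge i) m).+1)%N ->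
    (forall j, j != i -> (n <= wdeg (cycle_edge j) m)%N) ->
  ((u * n)./2 <= mdeg m)%N.
Proof.
move=> mi mj.
have : (wdeg (cycle_edge i) m + u.-1 * n <= (mdeg m).*2)%N.
  rewrite -sum_wdeg_cycle (bigD1 i) //= leq_add2l.
  by rewrite -{1}(card_ord u) -(cardC1 i) -sum_nat_const leq_sum.
have -> : (u * n = n + u.-1 * n)%N by rewrite -mulSn prednK //; lia.
(* This is the rounding: twice the degree is at least [u * n - 1]. *)
lia.
Qed.

Definition alternating n k := if odd k then n./2 else uphalf n.

Lemma alternatingD n k : (alternating n k + alternating n k.+1 = n)%N.
Proof. by rewrite /alternating /=; case: (odd k) => /=; lia. Qed.

Lemma sum_alternating n r :
  (\sum_(k < r) alternating n k.+1 =
     r./2 * n + if odd r then n./2 else 0)%N.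
Proof.
elim: r => [|r IHr]; first by rewrite big_ord0.
rewrite big_ord_recr /= IHr uphalf_half /alternating /=.
by case: (odd r) => /=; lia.
Qed.

(* The alternating exponents, corrected by -1 at vertex 0 and, unless both u
   and n are odd, by +1 at vertex u - 1. *)
Definition cycle_exponent n k : nat :=
  (alternating n k - (k == 0) + ((k == u.-1) && ~~ (odd u && odd n)))%N.

(** [cycle_exponent] handles the edge starting at vertex 0; rotating the exponents moves the
    deficient edge one vertex along. *)
Lemma cycle_mnm n i : (0 < n)%N -> exists m,
  [/\ wdeg (cycle_edge i) m = n.-1,
      forall j, j != i -> (n <= wdeg (cycle_edge j) m)%N &
      mdeg m = (u * n)./2].
Proof.
move=> n0; case: i => i; elim: i => [|i IHi] iu.
  exists [multinom cycle_exponent n (k : 'I_u) | k < u]; split.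
  - rewrite wdeg_cycle_edge !mnmE /= modn_small; last by lia.
    rewrite /cycle_exponent /alternating /=; lia.
  - move=> j j0; rewrite wdeg_cycle_edge !mnmE /=.
    have {}j0 : (0 < j)%N by rewrite lt0n.
    have := ltn_ord j; have := alternatingD n j.
    have [lt jn _|uj jn ju] := ltnP j.+1 u.
      by rewrite modn_small // /cycle_exponent eqn0Ngt j0 /= !subn0; lia.
    (* On the closing edge, if [u] and [n] are odd, both ends carry the ceiling and the surplus
       absorbs the -1; otherwise the +1 at [u.-1] compensates. *)
    have jE : j.+1 = u by lia.
    have ju1 : (j : nat) == u.-1 by lia.
    have ou : odd u = ~~ odd j by rewrite -[u in odd u]jE.
    rewrite jE modnn /cycle_exponent /alternating ou ju1 eqn0Ngt j0 /=.
    by case: (odd j) => /=; lia.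
  - rewrite mdegE; under eq_bigr do rewrite mnmE.
    have [v uE] : exists v, u = v.+2 by exists u.-2; lia.
    have -> : (\sum_(k < u) cycle_exponent n k =
        \sum_(k < v.+2) cycle_exponent n k)%N by rewrite uE.
    (* Both corrected vertices are split off; the interior is purely alternating. *)
    rewrite big_ord_recl big_ord_recr /=.
    have -> : (\sum_(k < v) cycle_exponent n (bump 0 (widen_ord (leqnSn v) k)) =
        \sum_(k < v) alternating n k.+1)%N.
      apply: eq_bigr => k _; rewrite /cycle_exponent /bump /= add1n subn0 uE /=.
      by rewrite eqSS (ltn_eqF (ltn_ord k)) addn0.
    rewrite sum_alternating /cycle_exponent /alternating /bump /= uE /= eqxx.
    have -> : ((v.+2 * n)./2 = v./2 * n + n + if odd v then n./2 else 0)%N.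
      have -> : (v.+2 * n = odd v * n + (v./2 * n + n).*2)%N.
        by rewrite -{1}(odd_double_half v); lia.
      by case: (odd v); lia.
    by case: (odd v) => /=; lia.
have [m [mi mj md]] := IHi (ltnW iu).
have wE j : wdeg (cycle_edge j) [multinom m (ord_pred k) | k < u] =
    wdeg (cycle_edge (ord_pred j)) m.
  by rewrite !wdeg_cycle_edge !mnmE ordSK ord_predK.
have iE : ord_pred (Ordinal iu) = Ordinal (ltnW iu).
  by apply: (can_inj (@ordSK u)); rewrite ord_predK; apply: val_inj; rewrite /= modn_small.
exists [multinom m (ord_pred k) | k < u]; split.
- by rewrite wE iE.
- move=> j ji; rewrite wE; apply: mj; apply: contra ji => /eqP ji.
  by apply/eqP/(can_inj (@ord_predK u)); rewrite ji iE.
- rewrite -md !mdegE [RHS](reindex_inj (can_inj (@ord_predK u))).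
  by apply: eq_bigr => k _; rewrite mnmE.
Qed.

End Cycle.

Theorem theorem4p8 (K : fieldType) (u : nat) (hu : (3 <= u)%N)
    (P : set {mpoly K[u]})
    (hP : stable_Ass (symbolic_power (cover_ideal K (cycle_graph u))) P)
    (n : nat) (hn : (1 <= n)%N) :
  let c : rat := 0 in
  let d : rat := if odd u then - (1 / 2) else 0 in
  exists v : nat,
    is_local_vnumber (symbolic_power (cover_ideal K (cycle_graph u)) n) P v /\
    v%:R = (if odd n then #|'I_u|%:R / 2 * n%:R + d
            else #|'I_u|%:R / 2 * n%:R + c) :> rat.
Proof.
move=> c d; have inc := cycle_edge_incomparable hu.
have symE k : symbolic_power (cover_ideal K (cycle_graph u)) k =
    inter_pow (@cycle_edge u) k.
  by rewrite cover_ideal_cycle symbolic_power_inter.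
(* One index of the stable range identifies [P] as an edge prime; the monomial of [cycle_mnm] then
   makes it associated at [n]. *)
case: hP => N /(_ N (leqnn N)); rewrite symE => /(Ass_inter_pow_sub inc)[i ->].
exists (u * n)./2; split; last first.
  (* The parity term equals 1 only for [u] and [n] both odd, which produces [d]. *)
  have -> : (u * n)./2%:R = ((u * n)%:R - (odd (u * n))%:R) / 2 :> rat.
    rewrite -[X in X%:R - _](odd_double_half (u * n)) natrD addrC addKr.
    by rewrite -muln2 natrM mulfK.
  rewrite card_ord oddM natrM mulrBl mulrAC /d /c.
  by case: (odd u) (odd n) => -[] /=; rewrite ?mul0r ?subr0 ?addr0.
have [m [mi mj md]] := cycle_mnm hu i hn.
case: n hn mi mj md => // n _ mi mj md; rewrite symE; split.
- exact: Ass_inter_powX mi mj.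
- by exists 'X_[m]; [rewrite dhomogX -md | apply: inter_pow_colonX].
- move=> e [f fe iE].
  have [m' fm' [m'i m'j]] := colon_inter_pow_mnm inc (set21 _ _) iE.
  (* By homogeneity, [e] is the degree of the monomial [m'] of [f]. *)
  by rewrite -(dhomogP _ _ _ fe _ fm'); apply: mdeg_cycle_ge m'i m'j.
Qed.
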